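(* Let $\sigma=\sigma^{\mathrm{FT}}:=\sigma^\infty+\delta\mathbf{1}$ for some $\delta>0$, with $\sigma^\infty$ the asymptotic restriction defined in the context. Assume that the restricted problem $\mathrm{LP}(\sigma^{\mathrm{FT}})$ is feasible and that its optimal solution is unique. Assume moreover that Slater's condition holds for $\sigma=\sigma^{\mathrm{FT}}$: there exists $(\hat z_1,\ldots,\hat z_N)$ (a Slater point) with $\hat z_i\in\mathrm{conv}(X_i)$ for all $i$ such that $$\zeta:=\min_{s\in\{1,\ldots,S\}}\Big[b-\sigma^{\mathrm{FT}}-\sum_{i=1}^N A_i\hat z_i\Big]_s>0.$$ Let the step-size sequence $\{\alpha^t\}_{t\ge 0}$, with each $\alpha^t\ge 0$, satisfy $\sum_{t=0}^\infty \alpha^t=\infty$ and $\sum_{t=0}^\infty(\alpha^t)^2<\infty$. Consider the mixed-integer sequence $\{x_1^t,\ldots,x_N^t\}_{t\ge0}$ generated by the distributed algorithm described in the context, with a sufficiently large $M>0$ and with initialization satisfying $\sum_{i=1}^N y_i^0=b-\sigma^{\mathrm{FT}}$. Let $\epsilon_i>0$ for $i\in\{1,\ldots,N\}$. Then there exists a time $T_\epsilon>0$ such that $(x_1^t,\ldots,x_N^t)$ satisfies $\sum_{i=1}^N c_i^\top x_i^t-J^{\mathrm{MILP}}\le B^t$ for all $t\ge T_\epsilon$, where $$B^t:=\sum_{i=1}^N\big(c_i^\top x_i^t-J_i^{\mathrm{LP},t}\big)+\sum_{i=1}^N\epsilon_i\|\mu_i^t\|_1+\Gamma\|\sigma^{\mathrm{FT}}\|_\infty.$$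 Here $J^{\mathrm{MILP}}$ is the optimal cost of the target MILP, $J_i^{\mathrm{LP},t}$ and $\mu_i^t$ are the optimal cost and a Lagrange multiplier (the one computed by the algorithm) of the local problem $\mathrm{Loc}_i(y_i^t)$ at time $t$, $\Gamma:=\frac{N}{\zeta}\sum_{i=1}^N\big(\max_{x_i\in X_i}c_i^\top x_i-\min_{x_i\in X_i}c_i^\top x_i\big)$, and $\zeta$ is associated to any Slater point.
   Context: Setting. There are $N$ agents and $S$ linear coupling constraints (the regime of interest is $N\gg S$; no quantitative relation is imposed). For each $i\in\{1,\ldots,N\}$: $X_i=P_i\cap(\mathbb{Z}^{p_i}\times\mathbb{R}^{q_i})$ with $P_i\subset\mathbb{R}^{p_i+q_i}$ a nonempty compact polyhedron, $c_i\in\mathbb{R}^{p_i+q_i}$, $A_i\in\mathbb{R}^{S\times(p_i+q_i)}$; and $b\in\mathbb{R}^S$. The target MILP is: minimize $\sum_{i=1}^N c_i^\top x_i$ subject to $\sum_{i=1}^N A_ix_i\le b$ and $x_i\in X_i$ for all $i$; it is assumed feasible. Vector inequalities are componentwise, $\max$ and $\min$ of vectors are componentwise, $[\cdot]_s$ is the $s$-th component, $\mathbf{1}$ is the vector of ones, and $\mathrm{conv}(X_i)$ is the convex hull of $X_i$. Restricted problem $\mathrm{LP}(\sigma)$, for $\sigma\in\mathbb{R}^S$, $\sigma\ge0$: minimize $\sum_{i=1}^N c_i^\top z_i$ over $z_1,\dots,z_N$ subject to $\sum_{i=1}^N A_iz_i\le b-\sigma$ and $z_i\in\mathrm{conv}(X_i)$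 for all $i$. Asymptotic restriction: let $L_i=\min_{x_i\in X_i}A_ix_i\in\mathbb{R}^S$ (componentwise), $\rho_i^{\max}=\min_{x_i\in X_i}\max_{s\in\{1,\ldots,S\}}[A_ix_i-L_i]_s$, $\sigma_i^{\mathrm{loc}}=\min\{\rho_i^{\max}\mathbf{1},\ \max_{x_i\in X_i}(A_ix_i-L_i)\}\in\mathbb{R}^S$ (componentwise), and $\sigma^\infty=S\cdot\max_{i\in\{1,\ldots,N\}}\sigma_i^{\mathrm{loc}}\in\mathbb{R}^S$ (componentwise). Communication graph: agents communicate over a connected undirected graph on $\{1,\ldots,N\}$; $\mathcal{N}_i$ is the set of neighbors of $i$. Local problem $\mathrm{Loc}_i(y_i)$, for a parameter $M>0$: minimize $c_i^\top z_i+Mv_i$ over $(z_i,v_i)$ subject to $A_iz_i\le y_i+v_i\mathbf{1}$, $z_i\in\mathrm{conv}(X_i)$, $v_i\ge 0$, with $v_i\in\mathbb{R}$. Lexicographic problem $\mathrm{Lex}_i(y_i)$: minimize lexicographically $\rho_i$, then $\xi_i$, over $(\rho_i,\xi_i,x_i)$ subject to $c_i^\top x_i\le\xi_i$, $A_ix_i\le y_i+\rho_i\mathbf{1}$, $x_i\in X_i$, $\rho_i\ge0$. Equivalently: first let $\bar\rho_i$ be the minimum of $\rho_i\ge 0$ such that some $x_i\in X_i$ satisfies $A_ix_i\le y_i+\rho_i\mathbf{1}$; then $x_i$ is a minimizer of $c_i^\top x_i$ over $x_i\in X_i$ with $A_ix_i\le y_i+\bar\rho_i\mathbf{1}$. Distributed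 algorithm: starting from $y_1^0,\ldots,y_N^0\in\mathbb{R}^S$, at each iteration $t\ge 0$, each agent $i$ computes a Lagrange multiplier $\mu_i^t$ of $\mathrm{Loc}_i(y_i^t)$ associated with the constraint $A_iz_i\le y_i^t+v_i\mathbf{1}$, receives $\mu_j^t$ from $j\in\mathcal{N}_i$, and updates $y_i^{t+1}=y_i^t+\alpha^t\sum_{j\in\mathcal{N}_i}(\mu_i^t-\mu_j^t)$. If halted at iteration $t$, agent $i$ returns $x_i^t$, the $x_i$-part of an optimal solution of $\mathrm{Lex}_i(y_i^t)$; the mixed-integer sequence is $\{x_1^t,\ldots,x_N^t\}_{t\ge 0}$. *)

(* Defs.v *)
From mathcomp Require Import all_boot all_order all_algebra.
From mathcomp Require Import all_classical all_reals all_analysis.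
Set Implicit Arguments.
Unset Strict Implicit.
Unset Printing Implicit Defensive.
Import Order.TTheory GRing.Theory Num.Theory.
Import numFieldNormedType.Exports.
Local Open Scope classical_set_scope.
Local Open Scope ring_scope.

Definition levec (R : realType) (n : nat) (u v : 'cV[R]_n) : Prop :=
  forall s : 'I_n, u s 0 <= v s 0.

Definition dot (R : realType) (n : nat) (u v : 'cV[R]_n) : R :=
  (u^T *m v) 0 0.

Definition norm1 (R : realType) (n : nat) (u : 'cV[R]_n) : R :=
  \sum_(s < n) `|u s 0|.

Definition polyhedron (R : realType) (n : nat) (P : set 'cV[R]_n) : Prop :=
  exists (m : nat) (G : 'M[R]_(m, n)) (h : 'cV[R]_m),
    P = [set x | levec (G *m x) h].

Definition conv (R : realType) (n : nat) (X : set 'cV[R]_n) : set 'cV[R]_n :=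
  [set x | exists (k : nat) (w : 'I_k -> R) (u : 'I_k -> 'cV[R]_n),
     [/\ forall j, 0 <= w j, \sum_(j < k) w j = 1, forall j, X (u j)
       & x = \sum_(j < k) w j *: u j]].
Arguments conv {R n} X _.

Record milp (R : realType) (N S : nat) := Milp {
  idim : 'I_N -> nat;
  rdim : 'I_N -> nat;
  polyh : forall i : 'I_N, set 'cV[R]_(idim i + rdim i);
  cost : forall i : 'I_N, 'cV[R]_(idim i + rdim i);
  coupl : forall i : 'I_N, 'M[R]_(S, idim i + rdim i);
  rhs : 'cV[R]_S
}.
Arguments polyh {R N S} D i _ : rename.
Arguments cost {R N S} D i : rename.
Arguments coupl {R N S} D i : rename.

(* The coordinates [lshift _ j] are the first [idim D i] ones, so the local
   set is P_i intersected with Z^(p_i) x R^(q_i). *)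
Definition locset (R : realType) (N S : nat) (D : milp R N S) (i : 'I_N) :
    set 'cV[R]_(idim D i + rdim D i) :=
  [set x | polyh D i x /\
     forall j : 'I_(idim D i), x (lshift (rdim D i) j) 0 \is a Num.int].
Arguments locset {R N S} D i _.

Definition profile (R : realType) (N S : nat) (D : milp R N S) : Type :=
  forall i : 'I_N, 'cV[R]_(idim D i + rdim D i).

Definition total_cost (R : realType) (N S : nat) (D : milp R N S)
    (x : profile D) : R :=
  \sum_(i < N) dot (cost D i) (x i).

Definition total_usage (R : realType) (N S : nat) (D : milp R N S)
    (x : profile D) : 'cV[R]_S :=
  \sum_(i < N) coupl D i *m x i.

Definition milp_feasible (R : realType) (N S : nat) (D : milp R N S) :
    set (profile D) :=
  [set x | levec (total_usage x) (rhs D) /\ forall i, locset D i (x i)].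
Arguments milp_feasible {R N S} D _.

(* Minima and maxima are written [inf] and [sup]. For [0 < N], [0 < S], [0 < M]
   and nonempty [locset D i] with compact polyhedra, all these extrema are
   attained, so the default value of [inf] and [sup] on empty or unbounded sets
   plays no role. *)

Definition J_MILP (R : realType) (N S : nat) (D : milp R N S) : R :=
  inf [set total_cost x | x in milp_feasible D].

Definition lp_feasible (R : realType) (N S : nat) (D : milp R N S)
    (sigma : 'cV[R]_S) : set (profile D) :=
  [set z | levec (total_usage z) (rhs D - sigma) /\
           forall i, conv (locset D i) (z i)].
Arguments lp_feasible {R N S} D sigma _.

Definition lp_optimal (R : realType) (N S : nat) (D : milp R N S)
    (sigma : 'cV[R]_S) : set (profile D) :=
  [set z | lp_feasible D sigma z /\
     forall z', lp_feasible D sigma z' -> total_cost z <= total_cost z'].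
Arguments lp_optimal {R N S} D sigma _.

Definition Lmin (R : realType) (N S : nat) (D : milp R N S) (i : 'I_N) :
    'cV[R]_S :=
  \col_s inf [set (coupl D i *m x) s 0 | x in locset D i].

Definition rho_max (R : realType) (N S : nat) (D : milp R N S) (i : 'I_N) : R :=
  inf [set sup (range (fun s : 'I_S => (coupl D i *m x - Lmin D i) s 0))
      | x in locset D i].

Definition sigma_loc (R : realType) (N S : nat) (D : milp R N S) (i : 'I_N) :
    'cV[R]_S :=
  \col_s Num.min (rho_max D i)
    (sup [set (coupl D i *m x - Lmin D i) s 0 | x in locset D i]).

Definition sigma_inf (R : realType) (N S : nat) (D : milp R N S) : 'cV[R]_S :=
  \col_s (S%:R * sup (range (fun i : 'I_N => sigma_loc D i s 0))).

Definition sigma_FT (R : realType) (N S : nat) (D : milp R N S) (delta : R) :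
    'cV[R]_S :=
  sigma_inf D + const_mx delta.

Definition slater_gap (R : realType) (N S : nat) (D : milp R N S)
    (sigma : 'cV[R]_S) (z : profile D) : R :=
  inf (range (fun s : 'I_S => (rhs D - sigma - total_usage z) s 0)).
Arguments slater_gap {R N S} D sigma z.

Definition slater_point (R : realType) (N S : nat) (D : milp R N S)
    (sigma : 'cV[R]_S) (z : profile D) : Prop :=
  (forall i, conv (locset D i) (z i)) /\ 0 < slater_gap D sigma z.
Arguments slater_point {R N S} D sigma z.

Definition Gamma (R : realType) (N S : nat) (D : milp R N S)
    (sigma : 'cV[R]_S) (z : profile D) : R :=
  N%:R / slater_gap D sigma z *
  \sum_(i < N) (sup [set dot (cost D i) x | x in locset D i] -
                inf [set dot (cost D i) x | x in locset D i]).
Arguments Gamma {R N S} D sigma z.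

Definition loc_feasible (R : realType) (N S : nat) (D : milp R N S) (i : 'I_N)
    (y : 'cV[R]_S) : set ('cV[R]_(idim D i + rdim D i) * R) :=
  [set zv | [/\ levec (coupl D i *m zv.1) (y + const_mx zv.2),
               conv (locset D i) zv.1 & 0 <= zv.2]].
Arguments loc_feasible {R N S} D i y _.

Definition loc_cost (R : realType) (N S : nat) (D : milp R N S) (M : R)
    (i : 'I_N) (zv : 'cV[R]_(idim D i + rdim D i) * R) : R :=
  dot (cost D i) zv.1 + M * zv.2.
Arguments loc_cost {R N S} D M i zv.

Definition J_loc (R : realType) (N S : nat) (D : milp R N S) (M : R)
    (i : 'I_N) (y : 'cV[R]_S) : R :=
  inf [set loc_cost D M i zv | zv in loc_feasible D i y].

(* The infimum of the Lagrangian is taken in the extended reals: it may be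
   -oo, whereas the real-valued [inf] of an unbounded set is 0. *)
Definition lagrange_multiplier (R : realType) (N S : nat) (D : milp R N S)
    (M : R) (i : 'I_N) (y mu : 'cV[R]_S) : Prop :=
  levec 0 mu /\
  ereal_inf
    [set (loc_cost D M i zv
          + dot mu (coupl D i *m zv.1 - (y + const_mx zv.2)))%:E
    | zv in [set zv : 'cV[R]_(idim D i + rdim D i) * R |
               conv (locset D i) zv.1 /\ 0 <= zv.2]]
  = (J_loc D M i y)%:E.
Arguments lagrange_multiplier {R N S} D M i y mu.

Definition lex_feasible (R : realType) (N S : nat) (D : milp R N S) (i : 'I_N)
    (y : 'cV[R]_S) (rho xi : R) (x : 'cV[R]_(idim D i + rdim D i)) : Prop :=
  [/\ dot (cost D i) x <= xi,
      levec (coupl D i *m x) (y + const_mx rho),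
      locset D i x & 0 <= rho].
Arguments lex_feasible {R N S} D i y rho xi x.

Definition lex_optimal (R : realType) (N S : nat) (D : milp R N S) (i : 'I_N)
    (y : 'cV[R]_S) (rho xi : R) (x : 'cV[R]_(idim D i + rdim D i)) : Prop :=
  lex_feasible D i y rho xi x /\
  forall rho' xi' x', lex_feasible D i y rho' xi' x' ->
    rho < rho' \/ (rho = rho' /\ xi <= xi').
Arguments lex_optimal {R N S} D i y rho xi x.

Definition connected_graph (N : nat) (e : rel 'I_N) : Prop :=
  symmetric e /\ forall i j, connect e i j.

Definition algorithm_run (R : realType) (N S : nat) (D : milp R N S)
    (e : rel 'I_N) (M : R) (alpha : nat -> R)
    (y mu : nat -> 'I_N -> 'cV[R]_S) (x : nat -> profile D) : Prop :=
  [/\ forall t i, lagrange_multiplier D M i (y t i) (mu t i),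
      forall t i, y t.+1 i =
        y t i + alpha t *: \sum_(j < N | e i j) (mu t i - mu t j)
    & forall t i, exists rho xi, lex_optimal D i (y t i) rho xi (x t i)].
Arguments algorithm_run {R N S} D e M alpha y mu x.

(* The norm of a matrix is the maximum of the absolute values of its entries,
   so [`|sigma|] is the infinity norm. *)
Definition Bound (R : realType) (N S : nat) (D : milp R N S) (M : R)
    (sigma : 'cV[R]_S) (zhat : profile D) (eps : 'I_N -> R)
    (y mu : 'I_N -> 'cV[R]_S) (x : profile D) : R :=
  \sum_(i < N) (dot (cost D i) (x i) - J_loc D M i (y i)) +
  \sum_(i < N) eps i * norm1 (mu i) +
  Gamma D sigma zhat * `|sigma|.
Arguments Bound {R N S} D M sigma zhat eps y mu x.

(* Main.v *)
Require Import Defs.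
From mathcomp Require Import all_boot all_order all_algebra.
From mathcomp Require Import all_classical all_reals all_analysis.
From mathcomp Require Import ring lra.
Import Order.TTheory GRing.Theory Num.Theory.
Import numFieldNormedType.Exports.
Local Open Scope classical_set_scope.
Local Open Scope ring_scope.
Set Implicit Arguments.
Unset Strict Implicit.
Unset Printing Implicit Defensive.

(** The mixed-integer costs cancel in the bound, which therefore only concerns
    the optimal values [J_loc] of the local problems: eventually
    [\sum_i J_loc (y t i)] must be at most
    [J_MILP + \sum_i eps i * norm1 (mu t i) + Gamma * `|sigma|].

    As a function of the allocation, each [J_loc] is Lipschitz and has [- mu]
    as a subgradient ([J_loc_lipschitz], [J_loc_subgradient]), with [mu] bounded
    by [M] ([multiplier_le]). The algorithm is thus a subgradient method, whose
    directions are multiplied by the Laplacian of the graph; this keeps the sum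
    of the allocations equal to [b - sigma]. For [M] large, the minimum of
    [\sum_i J_loc] over such allocations is the optimal cost of the restricted
    linear program ([sum_J_loc_ge], [lp_allocation_cost]). The method converges
    to a minimizer ([laplacian_subgradient_cvg]): the squared distance to any
    minimizer, in the norm given by the pseudo-inverse of the Laplacian
    ([energy]), increases by at most a summable amount.

    Once every allocation is within [min_i eps i] of its limit, the subgradient
    inequality bounds [\sum_i J_loc (y t i)] by the optimal cost of the
    restricted program plus [\sum_i eps i * norm1 (mu t i)]. Finally that cost
    exceeds [J_MILP] by at most [Gamma * `|sigma|] ([lp_le_milp]). Both this
    estimate and the exactness of the penalty [M] come from one construction,
    [lp_perturbation]: a profile that overuses the resources is made feasible by
    mixing it with a Slater point, at a cost proportional to the overuse. *)

(** * Dot products and convex hulls *)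

Lemma dotE (R : realType) n (u v : 'cV[R]_n) :
  dot u v = \sum_s u s 0 * v s 0.
Proof. by rewrite /dot !mxE; apply: eq_bigr => s _; rewrite mxE. Qed.

Lemma dotDr (R : realType) n (u v w : 'cV[R]_n) :
  dot u (v + w) = dot u v + dot u w.
Proof. by rewrite /dot mulmxDr mxE. Qed.

Lemma dotBr (R : realType) n (u v w : 'cV[R]_n) :
  dot u (v - w) = dot u v - dot u w.
Proof. by rewrite /dot mulmxBr !mxE. Qed.

Lemma dotZr (R : realType) n a (u v : 'cV[R]_n) : dot u (a *: v) = a * dot u v.
Proof. by rewrite /dot -scalemxAr mxE. Qed.

Lemma dot_sumr (R : realType) n (I : finType) (u : 'cV[R]_n) (F : I -> 'cV[R]_n) :
  dot u (\sum_i F i) = \sum_i dot u (F i).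
Proof. by rewrite /dot mulmx_sumr summxE. Qed.

Lemma dot_const (R : realType) n (u : 'cV[R]_n) v :
  dot u (const_mx v) = (\sum_s u s 0) * v.
Proof. by rewrite dotE mulr_suml; apply: eq_bigr => s _; rewrite mxE. Qed.

Lemma ler_dot (R : realType) n (u v w : 'cV[R]_n) :
  levec 0 u -> levec v w -> dot u v <= dot u w.
Proof.
move=> u0 vw; rewrite !dotE; apply: ler_sum => s _.
by apply: ler_wpM2l => //; have := u0 s; rewrite mxE.
Qed.

Lemma dot_le_norm1 (R : realType) n (u v : 'cV[R]_n) (eps : R) :
  (forall s, `|v s 0| <= eps) -> dot u v <= eps * norm1 u.
Proof.
move=> veps; rewrite dotE /norm1 mulr_sumr; apply: ler_sum => s _.
by rewrite (le_trans (ler_norm _))// normrM mulrC ler_wpM2r.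
Qed.

Lemma conv_sub (R : realType) n (X : set 'cV[R]_n) x : X x -> Defs.conv X x.
Proof.
move=> Xx; exists 1%N, (fun=> 1), (fun=> x); split => //.
- by rewrite big_ord1.
- by rewrite big_ord1 scale1r.
Qed.

Lemma conv_segment (R : realType) n (X : set 'cV[R]_n) x y (th : R) :
  0 <= th <= 1 -> Defs.conv X x -> Defs.conv X y -> Defs.conv X ((1 - th) *: x + th *: y).
Proof.
move=> /andP[th0 th1] [k1 [w1 [u1 [w1p w1s Xu1 ->]]]].
move=> [k2 [w2 [u2 [w2p w2s Xu2 ->]]]].
exists (k1 + k2)%N.
exists (fun j => match fintype.split j with inl a => (1 - th) * w1 a
                                          | inr b => th * w2 b end).
exists (fun j => match fintype.split j with inl a => u1 a | inr b => u2 b end).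
split.
- move=> j; case: (fintype.split j) => a; rewrite mulr_ge0 //.
  by rewrite subr_ge0.
- rewrite big_split_ord /=.
  under eq_bigr => i _ do rewrite (unsplitK (inl i)).
  under [X in _ + X]eq_bigr => i _ do rewrite (unsplitK (inr i)).
  by rewrite -!mulr_sumr w1s w2s !mulr1 subrK.
- by move=> j; case: (fintype.split j).
- rewrite big_split_ord /= !scaler_sumr; congr (_ + _); apply: eq_bigr => i _.
    by rewrite (unsplitK (inl i)) scalerA.
  by rewrite (unsplitK (inr i)) scalerA.
Qed.

(** A linear functional takes, on a convex combination, an average of its
    values at the combined points. *)
Lemma conv_dot_bounds (R : realType) n (X : set 'cV[R]_n) c lo hi z :
  (forall x, X x -> lo <= dot c x <= hi) -> Defs.conv X z -> lo <= dot c z <= hi.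
Proof.
move=> Xb [k [w [u [w0 w1 Xu ->]]]]; rewrite dot_sumr.
under eq_bigr => j _ do rewrite dotZr.
rewrite -[lo]mul1r -[hi]mul1r -w1 !mulr_suml.
by apply/andP; split; apply: ler_sum => j _; apply: ler_wpM2l => //;
  have /andP[] := Xb _ (Xu j).
Qed.

Lemma entry_le_norm (R : realType) m n (A : 'M[R]_(m, n)) i j : `|A i j| <= `|A|.
Proof.
rewrite [leRHS]/Num.norm /= mx_normrE.
by rewrite (le_bigmax _ (fun ij : _ * _ => `|A ij.1 ij.2|) (i, j)).
Qed.

Lemma compact_entry_bounded (R : realType) n (X : set 'cV[R]_n) :
  compact X -> exists K, forall x, X x -> forall j, `|x j 0| <= K.
Proof.
move=> /compact_bounded[K [_ KX]]; exists (K + 1) => x Xx j.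
have xK : `|x| <= K + 1 by apply: KX => //; rewrite ltrDl.
exact: le_trans (entry_le_norm _ _ _) xK.
Qed.

Lemma dot_bounded (R : realType) n (X : set 'cV[R]_n) (c : 'cV[R]_n) :
  compact X -> exists K, forall x, X x -> `|dot c x| <= K.
Proof.
move=> /compact_entry_bounded[K XK]; exists (\sum_s `|c s 0| * K) => x Xx.
rewrite dotE (le_trans (ler_norm_sum _ _ _))//; apply: ler_sum => s _.
by rewrite normrM ler_wpM2l // XK.
Qed.

Definition cost_min (R : realType) N S (D : milp R N S) i : R :=
  inf [set dot (cost D i) x | x in locset D i].

Definition cost_max (R : realType) N S (D : milp R N S) i : R :=
  sup [set dot (cost D i) x | x in locset D i].

Definition spread (R : realType) N S (D : milp R N S) : R :=
  \sum_i (cost_max D i - cost_min D i).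

Lemma conv_cost_bounds (R : realType) N S (D : milp R N S) i z :
  compact (polyh D i) -> Defs.conv (locset D i) z ->
  cost_min D i <= dot (cost D i) z <= cost_max D i.
Proof.
move=> /(dot_bounded (cost D i))[K PK]; apply: conv_dot_bounds => x Xx.
apply/andP; split.
- apply: ge_inf; last by exists x.
  exists (- K) => _ [x' [Px' _] <-].
  by have := PK _ Px'; rewrite ler_norml => /andP[].
- apply: ub_le_sup; last by exists x.
  exists K => _ [x' [Px' _] <-].
  by have := PK _ Px'; rewrite ler_norml => /andP[].
Qed.

Lemma total_cost_diff (R : realType) N S (D : milp R N S) (z z' : profile D) :
  (forall i, compact (polyh D i)) ->
  (forall i, Defs.conv (locset D i) (z i)) -> (forall i, Defs.conv (locset D i) (z' i)) ->
  total_cost z' - total_cost z <= spread D.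
Proof.
move=> cP cz cz'; rewrite /total_cost /spread -sumrB; apply: ler_sum => i _.
have /andP[lo _] := conv_cost_bounds (cP i) (cz i).
have /andP[_ hi] := conv_cost_bounds (cP i) (cz' i).
exact: lerB.
Qed.

(** * The local problems *)

Lemma J_loc_le (R : realType) N S (D : milp R N S) (M : R) i y zv :
  compact (polyh D i) -> 0 <= M -> loc_feasible D i y zv ->
  J_loc D M i y <= loc_cost D M i zv.
Proof.
move=> cP M0 fz; apply: ge_inf; last by exists zv.
exists (cost_min D i) => _ [[z v] [_ /= cz v0] <-]; rewrite /loc_cost /=.
have /andP[lo _] := conv_cost_bounds cP cz.
by rewrite (le_trans lo) // lerDl mulr_ge0.
Qed.

Lemma loc_feasible_neq0 (R : realType) N S (D : milp R N S) i y :
  locset D i !=set0 -> loc_feasible D i y !=set0.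
Proof.
move=> [x Xx]; set v := \sum_s `|(coupl D i *m x - y) s 0|.
exists (x, v); split => /=; last by apply: sumr_ge0.
- move=> s; rewrite 2!mxE [const_mx _ _ _]mxE -lerBlDl.
  rewrite (le_trans (ler_norm _))// /v (bigD1 s) //= !mxE lerDl.
  exact: sumr_ge0.
- exact: conv_sub.
Qed.

Lemma le_J_loc (R : realType) N S (D : milp R N S) (M : R) i y b :
  locset D i !=set0 ->
  (forall zv, loc_feasible D i y zv -> b <= loc_cost D M i zv) ->
  b <= J_loc D M i y.
Proof.
move=> /(loc_feasible_neq0 y)[zv fz] bl; apply: lb_le_inf.
  by exists (loc_cost D M i zv), zv.
by move=> _ [zv' fz' <-]; apply: bl.
Qed.

(** An allocation that shrinks by at most [eta] is repaired by raising the
    slack [v] by [eta], at cost [M * eta]. *)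
Lemma J_loc_lipschitz (R : realType) N S (D : milp R N S) (M : R) i
    (y y' : 'cV[R]_S) (eta : R) :
  compact (polyh D i) -> locset D i !=set0 -> 0 <= M -> 0 <= eta ->
  (forall s, `|y s 0 - y' s 0| <= eta) ->
  J_loc D M i y' <= J_loc D M i y + M * eta.
Proof.
move=> cP X0 M0 eta0 yy'; rewrite -lerBlDr; apply: le_J_loc => // -[z v].
move=> [/= Az cz v0]; rewrite lerBlDr.
have fz : loc_feasible D i y' (z, v + eta).
  split => //=; last by rewrite addr_ge0.
  move=> s; apply: le_trans (Az s) _; have := yy' s.
  by rewrite ler_norml !mxE => /andP[_ h]; lra.
by apply: le_trans (J_loc_le cP M0 fz) _; rewrite /loc_cost /=; lra.
Qed.

Lemma lagrangian_ge (R : realType) N S (D : milp R N S) (M : R) i y mu zv :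
  lagrange_multiplier D M i y mu -> Defs.conv (locset D i) zv.1 -> 0 <= zv.2 ->
  J_loc D M i y <=
  loc_cost D M i zv + dot mu (coupl D i *m zv.1 - (y + const_mx zv.2)).
Proof.
by move=> [_ Jmu] cz v0; rewrite -lee_fin -Jmu; apply: ereal_inf_lbound; exists zv.
Qed.

(** Strong duality makes [- mu] a subgradient at [y] of the optimal value as a
    function of the allocation. *)
Lemma J_loc_subgradient (R : realType) N S (D : milp R N S) (M : R) i y y' mu :
  locset D i !=set0 -> lagrange_multiplier D M i y mu ->
  J_loc D M i y <= J_loc D M i y' + dot mu (y' - y).
Proof.
move=> X0 Lmu; rewrite -lerBlDr; apply: le_J_loc => // zv [Az cz v0].
rewrite lerBlDr (le_trans (lagrangian_ge Lmu cz v0)) // lerD2l.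
apply: ler_dot => [|s]; first exact: Lmu.1.
by have := Az s; rewrite !mxE; lra.
Qed.

(** The dual function is finite only if the coefficient [M - \sum_s mu s] of
    the unbounded slack [v] is nonnegative. *)
Lemma multiplier_le (R : realType) N S (D : milp R N S) (M : R) i
    (y mu : 'cV[R]_S) s :
  locset D i !=set0 -> lagrange_multiplier D M i y mu -> `|mu s 0| <= M.
Proof.
move=> [x Xx] Lmu.
have mu0 s' : 0 <= mu s' 0 by have := Lmu.1 s'; rewrite mxE.
have cx : Defs.conv (locset D i) x by apply: conv_sub.
set m := \sum_s mu s 0.
suff mM : m <= M.
  rewrite ger0_norm // (le_trans _ mM) // /m (bigD1 s) //= lerDl.
  by apply: sumr_ge0.
rewrite leNgt; apply/negP => Mm.
set k := dot (cost D i) x + dot mu (coupl D i *m x - y) - J_loc D M i y.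
have kv v : 0 <= v -> 0 <= k - (m - M) * v.
  move=> v0; have := lagrangian_ge (zv := (x, v)) Lmu cx v0.
  by rewrite /loc_cost /= opprD addrA dotBr dot_const -/m /k; lra.
have k0 : 0 <= k by have := kv 0 (lexx 0); rewrite mulr0 subr0.
have mM0 : 0 < m - M by rewrite subr_gt0.
have v0 : 0 <= (k + 1) / (m - M).
  by apply: divr_ge0; [apply: addr_ge0 | apply: ltW].
by have := kv _ v0; rewrite mulrC divfK ?gt_eqF //; lra.
Qed.

(** * The restricted linear program *)

Lemma slater_gap_le (R : realType) N S (D : milp R N S) sigma (z : profile D) s :
  slater_gap D sigma z <= (rhs D - sigma - total_usage z) s 0.
Proof.
apply: ge_inf; last by exists s.
exists (- \sum_s `|(rhs D - sigma - total_usage z) s 0|) => _ [s' _ <-].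
rewrite lerNl (le_trans (ler_norm _)) // normrN (bigD1 s') //= lerDl.
by apply: sumr_ge0.
Qed.

(** If [z] exceeds the resources by at most [V], moving from [z] towards the
    Slater point by the fraction [V / (V + zeta)] restores feasibility, and
    this costs at most [V / zeta] times the spread of the costs. *)
Lemma lp_perturbation (R : realType) N S (D : milp R N S) sigma
    (zhat z zopt : profile D) (V : R) :
  (forall i, compact (polyh D i)) ->
  slater_point D sigma zhat -> lp_optimal D sigma zopt ->
  (forall i, Defs.conv (locset D i) (z i)) -> 0 <= V ->
  levec (total_usage z) (rhs D - sigma + const_mx V) ->
  total_cost zopt <= total_cost z + V / slater_gap D sigma zhat * spread D.
Proof.
move=> cP [czh gap0] [_ opt] cz V0 uz; set zeta := slater_gap _ _ _ in gap0 *.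
have Vz : 0 < V + zeta by lra.
pose th := V / (V + zeta).
have th0 : 0 <= th by rewrite divr_ge0 // ltW.
have th1 : th <= 1 by rewrite ler_pdivrMr // mul1r; lra.
have thV : (1 - th) * V = th * zeta by rewrite /th; field; rewrite gt_eqF.
pose w : profile D := fun i => (1 - th) *: z i + th *: zhat i.
have wE : total_usage w = (1 - th) *: total_usage z + th *: total_usage zhat.
  rewrite /total_usage !scaler_sumr -big_split /=; apply: eq_bigr => i _.
  by rewrite mulmxDr -!scalemxAr.
have fw : lp_feasible D sigma w.
  split=> [s|i]; last by apply: conv_segment => //; rewrite th0 th1.
  have h1 : (1 - th) * (total_usage z) s 0 <=
            (1 - th) * ((rhs D - sigma) s 0 + V).
    apply: ler_wpM2l; first by rewrite subr_ge0.
    by have := uz s; rewrite !mxE.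
  have h2 : th * zeta <= th * ((rhs D - sigma) s 0 - total_usage zhat s 0).
    apply: ler_wpM2l => //; have := slater_gap_le sigma zhat s.
    by rewrite -/zeta !mxE.
  by rewrite wE !mxE; move: h1 h2; rewrite !mxE; lra.
have cw : total_cost w = total_cost z + th * (total_cost zhat - total_cost z).
  rewrite /total_cost -sumrB mulr_sumr -big_split /=; apply: eq_bigr => i _.
  by rewrite dotDr !dotZr; ring.
rewrite (le_trans (opt _ fw)) // cw lerD2l.
have D0 : 0 <= spread D by have := total_cost_diff cP cz cz; rewrite subrr.
have d := total_cost_diff cP cz czh.
apply: (le_trans (ler_wpM2l th0 d)); apply: ler_wpM2r => //.
by rewrite /th ler_wpM2l // lef_pV2 ?posrE //; lra.
Qed.

(** Exact penalty: when [M] is at least the rate in [lp_perturbation], no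
    sharing of the resources beats the optimum of the linear program. *)
Lemma sum_J_loc_ge (R : realType) N S (D : milp R N S) sigma
    (zhat zopt : profile D) (M : R) (y : 'I_N -> 'cV[R]_S) :
  (forall i, compact (polyh D i)) -> (forall i, locset D i !=set0) ->
  slater_point D sigma zhat -> lp_optimal D sigma zopt ->
  spread D / slater_gap D sigma zhat <= M ->
  \sum_i y i = rhs D - sigma ->
  total_cost zopt <= \sum_i J_loc D M i (y i).
Proof.
move=> cP X0 sl zo Mbig ysum; apply/ler_addgt0Pr => eta eta0.
(* The errors of the [N] near-minimizers chosen below add up to at most
   [eta]. *)
pose eta' := eta / N.+1%:R.
have eta'0 : 0 < eta' by rewrite divr_gt0.
have /fin_all_exists[zv zvP] : forall i, exists zv,
    loc_feasible D i (y i) zv /\ loc_cost D M i zv <= J_loc D M i (y i) + eta'.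
  move=> i; apply: contrapT => no.
  have : J_loc D M i (y i) + eta' <= J_loc D M i (y i).
    apply: le_J_loc => // zv fz; rewrite leNgt; apply/negP => lt.
    by apply: no; exists zv; split => //; exact: ltW.
  by lra.
pose z : profile D := fun i => (zv i).1; pose V := \sum_i (zv i).2.
have V0 : 0 <= V by apply: sumr_ge0 => i _; case: (zvP i) => -[].
have cz i : Defs.conv (locset D i) (z i) by case: (zvP i) => -[].
have uz : levec (total_usage z) (rhs D - sigma + const_mx V).
  move=> s; rewrite -ysum [leRHS]mxE !summxE [const_mx _ _ _]mxE -big_split /=.
  by apply: ler_sum => i _; case: (zvP i) => -[/(_ s) + _ _ _]; rewrite [leRHS]mxE [const_mx _ _ _]mxE.
have le1 := lp_perturbation cP sl zo cz V0 uz.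
have le2 : \sum_i loc_cost D M i (zv i) <= \sum_i (J_loc D M i (y i) + eta').
  by apply: ler_sum => i _; case: (zvP i).
have costE : \sum_i loc_cost D M i (zv i) = total_cost z + M * V.
  by rewrite /loc_cost big_split /= -mulr_sumr.
have Neta : N%:R * eta' <= eta.
  by rewrite /eta' mulrCA ger_pMr // ler_pdivrMr // mul1r ler_nat.
have le3 : V / slater_gap D sigma zhat * spread D <= M * V.
  by rewrite mulrAC -mulrA [leRHS]mulrC ler_wpM2l.
move: le2; rewrite costE big_split /= sumr_const card_ord -mulr_natl.
by lra.
Qed.

(** Each agent receives what its part of the optimum consumes, plus an equal
    share of what is left over. *)
Definition lp_allocation (R : realType) N S (D : milp R N S) sigma
    (z : profile D) (i : 'I_N) : 'cV[R]_S :=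
  coupl D i *m z i + N%:R^-1 *: (rhs D - sigma - total_usage z).

Lemma lp_allocation_sum (R : realType) N S (D : milp R N S) sigma
    (z : profile D) :
  (0 < N)%N -> \sum_i lp_allocation sigma z i = rhs D - sigma.
Proof.
move=> N0; rewrite /lp_allocation big_split /= sumr_const card_ord.
by rewrite -scaler_nat scalerA divff ?pnatr_eq0 -?lt0n // scale1r addrC subrK.
Qed.

Lemma lp_allocation_cost (R : realType) N S (D : milp R N S) sigma (M : R)
    (z : profile D) :
  (forall i, compact (polyh D i)) -> 0 <= M -> lp_feasible D sigma z ->
  \sum_i J_loc D M i (lp_allocation sigma z i) <= total_cost z.
Proof.
move=> cP M0 [uz cz]; apply: ler_sum => i _.
have fz : loc_feasible D i (lp_allocation sigma z i) (z i, 0).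
  split => //= s; rewrite [leRHS]mxE [const_mx _ _ _]mxE addr0 [leRHS]mxE lerDl.
  rewrite mxE mulr_ge0 ?invr_ge0 //; have := uz s.
  by rewrite !mxE subr_ge0.
by have := J_loc_le (cP i) M0 fz; rewrite /loc_cost /= mulr0 addr0.
Qed.

Lemma lp_le_milp (R : realType) N S (D : milp R N S) (sigma : 'cV[R]_S)
    (zhat zopt : profile D) :
  (0 < N)%N -> (forall i, compact (polyh D i)) -> milp_feasible D !=set0 ->
  slater_point D sigma zhat -> lp_optimal D sigma zopt ->
  total_cost zopt <= J_MILP D + Gamma D sigma zhat * `|sigma|.
Proof.
move=> N0 cP [x0 fx0] sl zo; rewrite -lerBlDr; apply: lb_le_inf.
  by exists (total_cost x0), x0.
move=> _ [x [ux Xx] <-]; rewrite lerBlDr.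
have cx i : Defs.conv (locset D i) (x i) by apply: conv_sub.
have uz : levec (total_usage x) (rhs D - sigma + const_mx `|sigma|).
  move=> s; apply: (le_trans (ux s)); rewrite !mxE -addrA lerDl addrC subr_ge0.
  exact: le_trans (ler_norm _) (entry_le_norm _ _ _).
have := lp_perturbation cP sl zo cx (normr_ge0 sigma) uz.
move=> /le_trans; apply; rewrite lerD2l /Gamma.
rewrite -/(cost_max D) -/(cost_min D) -/(spread D).
have sp0 : 0 <= spread D.
  by have := total_cost_diff cP cx cx; rewrite subrr.
rewrite [leRHS]mulrC !mulrA -[leRHS]mulrA -[leLHS]mulrA ler_wpM2r //.
  by rewrite mulr_ge0 // invr_ge0 ltW // sl.2.
by rewrite ler_peMr // ler1n.
Qed.

(** * The graph Laplacian *)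

Definition lap_mx (R : realType) N (e : rel 'I_N) : 'M[R]_N :=
  \matrix_(i, j) \sum_(k | e i k) ((i == j)%:R - (k == j)%:R).

Lemma lap_mxE (R : realType) N S (e : rel 'I_N) (U : 'M[R]_(N, S)) i s :
  (lap_mx R e *m U) i s = \sum_(j | e i j) (U i s - U j s).
Proof.
have delta (k : 'I_N) : \sum_j (k == j)%:R * U j s = U k s.
  rewrite (bigD1 k) //= eqxx mul1r big1 ?addr0 // => j jk.
  by rewrite eq_sym (negbTE jk) mul0r.
rewrite mxE; under eq_bigr => j _ do rewrite mxE mulr_suml.
rewrite exchange_big /=; apply: eq_bigr => k _.
by under eq_bigr => j _ do rewrite mulrBl; rewrite sumrB !delta.
Qed.

Lemma trmx_lap (R : realType) N (e : rel 'I_N) :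
  symmetric e -> (lap_mx R e)^T = lap_mx R e.
Proof.
move=> e_sym; apply/matrixP => i j; rewrite !mxE.
have [-> //|ij] := eqVneq i j.
have offdiag (a b : 'I_N) :
    \sum_(k | e a k) (0%:R - (k == b)%:R) = - (e a b)%:R :> R.
  under eq_bigr => k _ do rewrite sub0r.
  rewrite sumrN; congr (- _); rewrite big_mkcond (bigD1 b) //= eqxx big1.
    by rewrite addr0; case: (e a b).
  by move=> k /negbTE ->; case: (e a k).
by rewrite !offdiag e_sym.
Qed.

Lemma lap_col_sum (R : realType) N S (e : rel 'I_N) (U : 'M[R]_(N, S)) s :
  symmetric e -> \sum_i (lap_mx R e *m U) i s = 0.
Proof.
move=> e_sym; under eq_bigr => i _ do rewrite mxE.
rewrite exchange_big big1 // => j _; rewrite -mulr_suml.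
suff -> : \sum_i lap_mx R e i j = 0 by rewrite mul0r.
rewrite -(trmx_lap R e_sym); under eq_bigr => i _ do rewrite mxE.
transitivity ((lap_mx R e *m (const_mx 1 : 'cV[R]_N)) j 0); last first.
  by rewrite lap_mxE big1 // => i _; rewrite !mxE subrr.
by rewrite [RHS]mxE; apply: eq_bigr => i _; rewrite [const_mx _ _ _]mxE mulr1.
Qed.

Lemma lap_form (R : realType) N S (e : rel 'I_N) (U : 'M[R]_(N, S)) :
  symmetric e ->
  \tr (U^T *m (lap_mx R e *m U)) *+ 2 =
    \sum_s \sum_i \sum_(j | e i j) (U i s - U j s) ^+ 2.
Proof.
move=> e_sym; rewrite /mxtrace -sumrMnl; apply: eq_bigr => s _.
rewrite mxE; under eq_bigr => i _ do rewrite mxE lap_mxE mulr_sumr.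
rewrite mulr2n.
have -> : \sum_i \sum_(j | e i j) U i s * (U i s - U j s) =
          \sum_i \sum_(j | e i j) U j s * (U j s - U i s).
  under eq_bigr => i _ do rewrite big_mkcond.
  rewrite exchange_big /=; apply: eq_bigr => i _.
  by rewrite [RHS]big_mkcond; apply: eq_bigr => j _; rewrite e_sym.
rewrite -{1}[X in X + _](_ : \sum_i \sum_(j | e i j) U i s * (U i s - U j s) = _).
  rewrite -big_split; apply: eq_bigr => i _; rewrite -big_split.
  by apply: eq_bigr => j _ /=; ring.
under eq_bigr => i _ do rewrite big_mkcond.
rewrite exchange_big /=; apply: eq_bigr => i _.
by rewrite [RHS]big_mkcond; apply: eq_bigr => j _; rewrite e_sym.
Qed.

(** By [lap_form], a vector in the kernel has equal entries at the two ends of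
    every edge. *)
Lemma lap_ker (R : realType) N (e : rel 'I_N) (u : 'cV[R]_N) :
  connected_graph e -> lap_mx R e *m u = 0 -> forall i j, u i 0 = u j 0.
Proof.
move=> [e_sym econ] Lu; have := lap_form u e_sym; rewrite Lu mulmx0 mxtrace0 mul0rn.
rewrite big_ord1 => /esym/eqP.
have sq0 i : 0 <= \sum_(j | e i j) (u i 0 - u j 0) ^+ 2.
  by apply: sumr_ge0 => j _; apply: sqr_ge0.
rewrite psumr_eq0 => [|i _]; last exact: sq0.
move=> /allP u0.
have edge i j : e i j -> u i 0 = u j 0.
  move=> eij; have := u0 i (mem_index_enum i); rewrite psumr_eq0 => [|k _].
    move=> /allP/(_ j (mem_index_enum j)); rewrite eij sqrf_eq0 subr_eq0.
    by move/eqP.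
  exact: sqr_ge0.
move=> i j; have /connectP[p + ->] := econ i j.
by elim: p i => //= k p IH i /andP[/edge -> /IH].
Qed.

(** A row vector lies in the row space of the Laplacian iff the columns of the
    cokernel annihilate it; by [lap_ker] these columns are constant. *)
Lemma lap_image (R : realType) N S (e : rel 'I_N) (D : 'M[R]_(N, S)) :
  connected_graph e -> (forall s, \sum_i D i s = 0) ->
  exists W, D = lap_mx R e *m W.
Proof.
move=> econ D0; have [e_sym _] := econ; pose L := lap_mx R e.
have DL : (D^T <= L)%MS.
  rewrite submxE; apply/eqP/matrixP => s k; rewrite !mxE.
  case: N => [|N] in e D econ e_sym D0 L k *; first by case: k.
  have cst i : cokermx L i k = cokermx L 0 k.
    have Lk : L *m col k (cokermx L) = 0.
      by rewrite colE mulmxA mulmx_coker mul0mx.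
    by have := lap_ker econ Lk i 0; rewrite !mxE.
  under eq_bigr => i _ do rewrite mxE cst.
  by rewrite -mulr_suml D0 mul0r.
exists (D^T *m pinvmx L)^T; rewrite -[in RHS](trmx_lap R e_sym) -trmx_mul.
by rewrite mulmxKpV // trmxK.
Qed.

(** On a matrix [lap *m W] this is the Dirichlet energy of [W], and it
    depends on [W] only through [lap *m W]: it is the squared norm for which
    the distributed update is a subgradient step. *)
Definition energy (R : realType) N S (e : rel 'I_N) (D : 'M[R]_(N, S)) : R :=
  \tr (D^T *m pinvmx (lap_mx R e) *m D).

Lemma energy_lap (R : realType) N S (e : rel 'I_N) (W : 'M[R]_(N, S)) :
  symmetric e ->
  energy e (lap_mx R e *m W) = \tr (W^T *m (lap_mx R e *m W)).
Proof.
move=> e_sym; rewrite /energy trmx_mul trmx_lap //.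
have := mulmxKpV (submx_refl (lap_mx R e)).
by move: (pinvmx _) => G LGL; rewrite -[in RHS]LGL !mulmxA.
Qed.

Lemma energy_step (R : realType) N S (e : rel 'I_N) (D U : 'M[R]_(N, S)) a :
  connected_graph e -> (forall s, \sum_i D i s = 0) ->
  energy e (D + a *: (lap_mx R e *m U)) =
    energy e D + a * \tr (U^T *m D) *+ 2
    + a ^+ 2 * \tr (U^T *m (lap_mx R e *m U)).
Proof.
move=> econ /(lap_image econ)[W ->]; have [e_sym _] := econ.
set L := lap_mx R e.
have -> : L *m W + a *: (L *m U) = L *m (W + a *: U).
  by rewrite mulmxDr scalemxAr.
rewrite !energy_lap // -/L.
have cross : \tr (W^T *m (L *m U)) = \tr (U^T *m (L *m W)).
  by rewrite -mxtrace_tr !trmx_mul trmxK trmx_lap // mulmxA.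
rewrite linearD /= linearZ /= mulmxDl !mulmxDr -!scalemxAl -!scalemxAr.
by rewrite !mxtraceD !mxtraceZ cross; ring.
Qed.

Lemma sum_sqr_le (R : realType) (I : finType) (P : pred I) (a : I -> R) :
  (\sum_(i | P i) a i) ^+ 2 <= #|I|%:R * \sum_(i | P i) a i ^+ 2.
Proof.
pose b i := if P i then a i else 0.
have -> : \sum_(i | P i) a i = \sum_i b i by rewrite big_mkcond.
have -> : \sum_(i | P i) a i ^+ 2 = \sum_i b i ^+ 2.
  rewrite big_mkcond; apply: eq_bigr => i _.
  by rewrite /b; case: (P i); rewrite ?expr0n.
move: b => {P}{}a.
have : 0 <= \sum_i \sum_j (a i - a j) ^+ 2.
  by apply: sumr_ge0 => i _; apply: sumr_ge0 => j _; apply: sqr_ge0.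
have -> : \sum_i \sum_j (a i - a j) ^+ 2 =
  (#|I|%:R * \sum_i a i ^+ 2 - (\sum_i a i) ^+ 2) *+ 2.
  transitivity (\sum_i (#|I|%:R * a i ^+ 2 - a i * (\sum_j a j) *+ 2
                       + \sum_j a j ^+ 2)).
    apply: eq_bigr => i _; under eq_bigr => j _ do rewrite sqrrB.
    rewrite big_split sumrB /= sumr_const; congr (_ - _ + _).
      by rewrite mulr_natl.
    by rewrite mulr_sumr -sumrMnl.
  rewrite big_split sumrB /= -mulr_sumr sumr_const -mulr_natl sumrMnl -mulr_suml.
  by ring.
by rewrite pmulrn_lge0 // subr_ge0.
Qed.

(** With [D = lap *m W], the entry [D i s] is a sum of at most [N] edge
    differences of [W], to which Cauchy-Schwarz applies. *)
Lemma sqr_entry_le_energy (R : realType) N S (e : rel 'I_N) (D : 'M[R]_(N, S)) :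
  connected_graph e -> (forall s, \sum_i D i s = 0) ->
  forall i s, D i s ^+ 2 <= (N.*2)%:R * energy e D.
Proof.
move=> econ /(lap_image econ)[W ->] i s; have [e_sym _] := econ.
rewrite energy_lap // -muln2 natrM -mulrA [2%:R * _]mulr_natl lap_form // lap_mxE.
apply: (le_trans (sum_sqr_le _ _)); rewrite card_ord ler_wpM2l //.
rewrite (bigD1 s) //= [X in _ <= X + _](bigD1 i) //= -addrA lerDl.
by apply: addr_ge0; repeat (apply: sumr_ge0 => ? _); apply: sqr_ge0.
Qed.

Lemma energy_ge0 (R : realType) N S (e : rel 'I_N) (D : 'M[R]_(N, S)) :
  connected_graph e -> (forall s, \sum_i D i s = 0) -> 0 <= energy e D.
Proof.
move=> econ /(lap_image econ)[W ->]; have [e_sym _] := econ.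
rewrite energy_lap // -(pmulrn_lge0 _ (n := 2)) // lap_form //.
by repeat (apply: sumr_ge0 => ? _); apply: sqr_ge0.
Qed.

Lemma quad_form_le (R : realType) N S (B : 'M[R]_N) (D : 'M[R]_(N, S)) K :
  (forall i s, `|D i s| <= K) ->
  \tr (D^T *m B *m D) <= (\sum_(s < S) \sum_i \sum_j `|B i j|) * K ^+ 2.
Proof.
move=> DK; rewrite mulr_suml; apply: ler_sum => s _.
rewrite -mulmxA mxE mulr_suml; apply: ler_sum => i _.
rewrite mxE mxE mulr_sumr mulr_suml; apply: ler_sum => j _.
apply: (le_trans (ler_norm _)); rewrite 2!normrM mulrCA ler_wpM2l // expr2.
by apply: ler_pM.
Qed.

(** * Convergence of the distributed subgradient method *)

(** If the gaps stayed above a positive [eta], the divergence of the step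
    sizes would drive the nonnegative [E] to minus infinity. *)
Lemma fejer_gap (R : realType) (alpha E gap : nat -> R) (C : R) :
  (forall t, 0 <= alpha t) -> series alpha @ \oo --> +oo ->
  cvgn (series (fun t => alpha t ^+ 2)) -> 0 <= C -> (forall t, 0 <= E t) ->
  (forall t, E t.+1 <= E t - alpha t * gap t + alpha t ^+ 2 * C) ->
  forall (eta : R) n, 0 < eta -> exists2 t, (n <= t)%N & gap t < eta.
Proof.
move=> a0 asum asq C0 E0 Estep eta n eta0; apply: contrapT => no.
have gap_ge t : (n <= t)%N -> eta <= gap t.
  by move=> nt; rewrite leNgt; apply/negP => ?; apply: no; exists t.
pose q := series (fun t => alpha t ^+ 2).
have q_nd : nondecreasing_seq q.
  by apply: nondecreasing_series => k _ _; apply: sqr_ge0.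
have Ebound k : E (n + k)%N <= E n - eta * (series alpha (n + k)%N - series alpha n)
                             + C * (q (n + k)%N - q n).
  elim: k => [|k IH]; first by rewrite addn0 !subrr !mulr0; lra.
  rewrite addnS (le_trans (Estep _)) // /q !seriesSr -/q.
  have : alpha (n + k)%N * eta <= alpha (n + k)%N * gap (n + k)%N.
    by rewrite ler_wpM2l // gap_ge // leq_addr.
  by move: IH; rewrite /q; lra.
have [m _ mP] := (cvgryPge (series alpha)).1 asum
  (series alpha n + (E n + C * (limn q - q n) + 1) / eta).
have := mP (n + m)%N (leq_addl _ _); rewrite /= -lerBrDl ler_pdivrMr // => big.
have qle : C * (q (n + m)%N - q n) <= C * (limn q - q n).
  by rewrite ler_wpM2l // lerD2r nondecreasing_cvgn_le.
have := Ebound m; have := E0 (n + m)%N; rewrite mulrC in big; lra.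
Qed.

(** Past the time from which the tail of the squares is small, [E] cannot
    grow much again after being small once. *)
Lemma fejer_small (R : realType) (alpha E : nat -> R) (C : R) :
  cvgn (series (fun t => alpha t ^+ 2)) -> 0 <= C ->
  (forall t, E t.+1 <= E t + alpha t ^+ 2 * C) ->
  (forall (eta : R) n, 0 < eta -> exists2 t, (n <= t)%N & E t <= eta) ->
  forall eta : R, 0 < eta -> exists T, forall t, (T <= t)%N -> E t <= eta.
Proof.
move=> asq C0 Estep Einf eta eta0.
pose q := series (fun t => alpha t ^+ 2).
have q_nd : nondecreasing_seq q.
  by apply: nondecreasing_series => k _ _; apply: sqr_ge0.
have tol : 0 < eta / 2 / (C + 1) by rewrite !divr_gt0 //; lra.
have [T0 _ T0P] := (cvgrPdist_le q (limn q)).1 asq _ tol.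
have eta2 : 0 < eta / 2 by rewrite divr_gt0.
have [T T0T ET] := Einf _ T0 eta2.
exists T => t /subnK <-; move: (t - T)%N => k {t}; rewrite addnC.
have Ebound : E (T + k)%N <= E T + C * (q (T + k)%N - q T).
  elim: k => [|k IH]; first by rewrite addn0 subrr mulr0 addr0.
  by rewrite addnS (le_trans (Estep _)) // /q seriesSr -/q; move: IH; rewrite /q; lra.
have h1 : q (T + k)%N <= limn q by apply: nondecreasing_cvgn_le.
have := T0P T T0T; rewrite /= ger0_norm ?subr_ge0 ?nondecreasing_cvgn_le // => h2.
have : C * (q (T + k)%N - q T) <= C * (eta / 2 / (C + 1)).
  by rewrite ler_wpM2l //; lra.
have : C * (eta / 2 / (C + 1)) <= eta / 2.
  by rewrite mulrCA ger_pMr ?divr_gt0 // ler_pdivrMr; lra.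
lra.
Qed.

Lemma matrix_cluster (R : realType) m n (Y : nat -> 'M[R]_(m, n)) (K : R) :
  (forall t i j, `|Y t i j| <= K) ->
  exists Z : 'M[R]_(m, n), forall (eta : R) k, 0 < eta ->
    exists2 t, (k <= t)%N & forall i j, `|Y t i j - Z i j| <= eta.
Proof.
move=> YK.
pose B := [set v : 'rV[R]_(m * n) | forall j, [set x : R | `|x| <= K] (v ord0 j)].
have cB : compact B.
  apply: (@rV_compact R _ (fun=> [set x : R | `|x| <= K])) => j.
  have -> : [set x : R | `|x| <= K] = `[- K, K]%classic.
    by apply/seteqP; split => x /=; rewrite in_itv /= ler_norml.
  exact: segment_compact.
pose F := (fun t => mxvec (Y t)) @ \oo.
have FB : F B.
  by exists 0%N => // t _ j /=; case/mxvec_indexP: j => i j; rewrite mxvecE.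
have [v [_ clv]] := cB F _ FB.
exists (vec_mx v) => eta k eta0.
have Fk : F [set mxvec (Y t) | t in [set t | (k <= t)%N]].
  by exists k => // t kt; exists t.
have Nv : nbhs v (ball v eta) by apply: nbhsx_ballx.
have [_ [[t kt <-] vt]] := clv _ _ Fk Nv.
exists t => // i j; move: vt; rewrite -ball_normE /= => /ltW; apply: le_trans.
have := entry_le_norm (v - mxvec (Y t)) 0 (mxvec_index i j).
by rewrite 2!mxE mxvecE [X in _ -> X <= _]distrC [vec_mx v i j]mxE.
Qed.

(** The classical argument for the projected subgradient method, with the
    Laplacian in place of the projection and [energy] in place of the squared
    Euclidean norm. The squared distance to any minimizer increases by at most a summable
    amount, so [Y] is bounded and its gaps come arbitrarily close to zero;
    boundedness gives a cluster point of a subsequence along which the gaps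
    vanish. That point is a minimizer, so the distance to it is also almost
    decreasing, and being small once it stays small. *)
Lemma laplacian_subgradient_cvg (R : realType) N S (e : rel 'I_N)
    (F : 'M[R]_(N, S) -> R) (K M : R) (alpha : nat -> R)
    (Y U : nat -> 'M[R]_(N, S)) (Ymin : 'M[R]_(N, S)) :
  connected_graph e ->
  (forall t, 0 <= alpha t) -> series alpha @ \oo --> +oo ->
  cvgn (series (fun t => alpha t ^+ 2)) ->
  0 <= K ->
  (forall (eta : R) (Z Z' : 'M[R]_(N, S)), 0 <= eta -> (forall i s, `|Z i s - Z' i s| <= eta) ->
     F Z' <= F Z + K * eta) ->
  (forall t i s, `|U t i s| <= M) ->
  (forall t Z, F (Y t) <= F Z + \tr ((U t)^T *m (Z - Y t))) ->
  (forall t, Y t.+1 = Y t + alpha t *: (lap_mx R e *m U t)) ->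
  (forall s, \sum_i Ymin i s = \sum_i Y 0%N i s) ->
  (forall Z : 'M[R]_(N, S),
     (forall s, \sum_i Z i s = \sum_i Y 0%N i s) -> F Ymin <= F Z) ->
  exists2 Z, F Z <= F Ymin &
    forall eta : R, 0 < eta -> exists T, forall t, (T <= t)%N ->
      forall i s, `|Z i s - Y t i s| <= eta.
Proof.
move=> econ a0 asum asq K0 Flip UM subg step Ysum Fmin; have [e_sym _] := econ.
have Ytsum t s : \sum_i Y t i s = \sum_i Y 0%N i s.
  elim: t => // t IH; rewrite step.
  under eq_bigr => i _ do rewrite mxE [X in _ + X]mxE.
  by rewrite big_split /= -mulr_sumr lap_col_sum // mulr0 addr0.
have dsum t (Z : 'M[R]_(N, S)) : (forall s, \sum_i Z i s = \sum_i Y 0%N i s) ->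
    forall s, \sum_i (Y t - Z) i s = 0.
  move=> Zs s; under eq_bigr => i _ do rewrite !mxE.
  by rewrite sumrB Ytsum Zs subrr.
pose C : R := (\sum_(s < S) \sum_i \sum_j `|lap_mx R e i j|) * M ^+ 2.
have C0 : 0 <= C.
  by rewrite mulr_ge0 ?sqr_ge0 //; do 3 (apply: sumr_ge0 => ? _).
have Estep (Z : 'M[R]_(N, S)) t : (forall s, \sum_i Z i s = \sum_i Y 0%N i s) ->
    energy e (Y t.+1 - Z) <=
    energy e (Y t - Z) - alpha t * ((F (Y t) - F Z) *+ 2) + alpha t ^+ 2 * C.
  move=> Zs; rewrite step addrAC energy_step //; last exact: dsum.
  apply: lerD; last by rewrite ler_wpM2l ?sqr_ge0 // mulmxA; apply: quad_form_le.
  rewrite lerD2l -mulrnAr -mulrN ler_wpM2l // -mulNrn lerMn2r /=.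
  by have := subg t Z; rewrite -opprB mulmxN raddfN /=; lra.
have cmp t : F Ymin <= F (Y t) by apply: Fmin => s; rewrite Ytsum.
have E0 t : 0 <= energy e (Y t - Ymin) by apply: energy_ge0 => //; exact: dsum.
(* [phi] selects times at which the gap tends to zero. *)
have /choice[phi phiP] n :
    exists t, (n <= t)%N /\ (F (Y t) - F Ymin) *+ 2 < n.+1%:R^-1.
  have n0 : 0 < n.+1%:R^-1 :> R by rewrite invr_gt0.
  have [t nt gt] := fejer_gap a0 asum asq C0 E0 (fun t => Estep Ymin t Ysum) n n0.
  by exists t.
pose q := series (fun t => alpha t ^+ 2).
have q_nd : nondecreasing_seq q.
  by apply: nondecreasing_series => k _ _; apply: sqr_ge0.
have Ebd t : energy e (Y t - Ymin) <= energy e (Y 0%N - Ymin) + C * limn q.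
  have : energy e (Y t - Ymin) <= energy e (Y 0%N - Ymin) + C * q t.
    elim: t => [|t IH]; first by rewrite /q /series /= big_geq // mulr0 addr0.
    rewrite (le_trans (Estep _ _ Ysum)) // /q seriesSr -/q.
    have : 0 <= alpha t * ((F (Y t) - F Ymin) *+ 2).
      by rewrite mulr_ge0 // mulrn_wge0 // subr_ge0.
    by move: IH; rewrite /q; lra.
  move=> /le_trans; apply; rewrite lerD2l ler_wpM2l //.
  exact: nondecreasing_cvgn_le.
set E1 := _ + _ in Ebd.
have Ybd t i s : `|Y t i s| <= (N.*2)%:R * E1 + 1 + \sum_i \sum_s `|Ymin i s|.
  have h := sqr_entry_le_energy econ (dsum t Ymin Ysum) i s.
  have {h} h := le_trans h (ler_wpM2l (ler0n _ _) (Ebd t)).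
  have h1 : `|Ymin i s| <= \sum_i \sum_s `|Ymin i s|.
    rewrite (bigD1 i) //= (bigD1 s) //= -addrA lerDl.
    by apply: addr_ge0; repeat (apply: sumr_ge0 => ? _).
  have h2 : `|(Y t - Ymin) i s| <= (Y t - Ymin) i s ^+ 2 + 1.
    by rewrite -real_normK ?num_real //; nra.
  have : `|Y t i s| <= `|(Y t - Ymin) i s| + `|Ymin i s|.
    by rewrite -{1}[Y t i s](subrK (Ymin i s)) !mxE ler_normD.
  lra.
have [Z Zcl] := matrix_cluster (fun n => Ybd (phi n)).
have FZ : F Z <= F Ymin.
  apply/ler_addgt0Pr => eta eta0.
  have [tol tol0 Ktol] : exists2 tol : R, 0 < tol & K * tol <= eta / 2.
    exists (eta / 2 / (K + 1)); first by rewrite !divr_gt0 //; lra.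
    by rewrite mulrCA ger_pMr ?divr_gt0 // ler_pdivrMr; lra.
  have [k _ kP] := near_infty_natSinv_lt (PosNum eta0).
  have [n kn Zn] := Zcl _ k tol0.
  have gapn : (F (Y (phi n)) - F Ymin) *+ 2 < eta.
    exact: lt_trans (phiP n).2 (kP n kn).
  rewrite (le_trans (Flip _ _ _ (ltW tol0) Zn)) //.
  by move: gapn Ktol; rewrite mulr2n; lra.
have Zsum s : \sum_i Z i s = \sum_i Y 0%N i s.
  apply/eqP; rewrite -subr_eq0 -normr_le0; apply/ler_addgt0Pr => eta eta0.
  have tol : 0 < eta / N.+1%:R by rewrite divr_gt0.
  have [n _ Zn] := Zcl _ 0%N tol.
  rewrite add0r -(Ytsum (phi n)) -sumrB.
  rewrite (le_trans (ler_norm_sum _ _ _)) //.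
  apply: (@le_trans _ _ (\sum_(i < N) (eta / N.+1%:R))).
    by apply: ler_sum => i _; rewrite distrC.
  rewrite sumr_const card_ord -[leLHS]mulr_natl mulrCA ger_pMr //.
  by rewrite ler_pdivrMr // mul1r ler_nat.
exists Z => // eta eta0.
have Esmall := @fejer_small R alpha (fun t => energy e (Y t - Z)) C asq C0.
have {Esmall} [] := Esmall _ _ (eta ^+ 2 / (N.*2.+1)%:R).
- move=> t; rewrite (le_trans (Estep _ _ Zsum)) // lerD2r gerBl mulr_ge0 //.
  rewrite mulrn_wge0 // subr_ge0 (le_trans FZ) //.
- move=> th n th0.
  pose B : R := \sum_(s < S) \sum_i \sum_j `|pinvmx (lap_mx R e) i j|.
  have B0 : 0 <= B by do 3 (apply: sumr_ge0 => ? _).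
  have tol : 0 < Num.sqrt (th / (B + 1)) by rewrite sqrtr_gt0 divr_gt0 //; lra.
  have [k nk Zk] := Zcl _ n tol; exists (phi k); first exact: leq_trans nk (phiP k).1.
  have := quad_form_le (pinvmx (lap_mx R e)) (D := Y (phi k) - Z) (K := Num.sqrt (th / (B + 1))).
  rewrite -/B sqr_sqrtr ?divr_ge0 //; try lra.
  move=> h; apply: (le_trans (h _)); first by move=> i s; rewrite !mxE.
  by rewrite mulrCA ger_pMr // ler_pdivrMr; lra.
- by rewrite divr_gt0 // exprn_gt0.
move=> T TP; exists T => t /TP Et i s.
have := sqr_entry_le_energy econ (dsum t Z Zsum) i s.
have h1 := ler_wpM2l (ler0n R N.*2) Et.
move=> h; have {h h1} h := le_trans h h1.
rewrite distrC -(ler_pXn2r (_ : (0 < 2)%N)) ?nnegrE ?(ltW eta0) //.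
rewrite real_normK ?num_real //; move: h; rewrite !mxE => /le_trans; apply.
by rewrite mulrCA ger_pMr ?exprn_gt0 // ler_pdivrMr // mul1r ler_nat.
Qed.

(** * The cost bound *)

Theorem mainTheorem6 (R : realType) (N S : nat) (N_gt0 : (0 < N)%N)
    (S_gt0 : (0 < S)%N) (D : milp R N S)
    (Ppoly : forall i, polyhedron (polyh D i))
    (Pcompact : forall i, compact (polyh D i))
    (Pnonempty : forall i, polyh D i !=set0)
    (milp_feas : milp_feasible D !=set0)
    (e : rel 'I_N) (e_conn : connected_graph e)
    (delta : R) (delta_gt0 : 0 < delta)
    (lp_feas : lp_feasible D (sigma_FT D delta) !=set0)
    (lp_uniq : exists! z, lp_optimal D (sigma_FT D delta) z)
    (slater : exists zhat, slater_point D (sigma_FT D delta) zhat) :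
  exists2 M0 : R, 0 < M0 &
  forall (M : R) (M_large : M0 < M)
    (alpha : nat -> R) (alpha_ge0 : forall t, 0 <= alpha t)
    (alpha_sum : series alpha @ \oo --> +oo)
    (alpha_sqsum : cvgn (series (fun t => alpha t ^+ 2)))
    (y mu : nat -> 'I_N -> 'cV[R]_S) (x : nat -> profile D)
    (y_init : \sum_(i < N) y 0%N i = rhs D - sigma_FT D delta)
    (run : algorithm_run D e M alpha y mu x)
    (eps : 'I_N -> R) (eps_gt0 : forall i, 0 < eps i),
  exists2 T : nat, (0 < T)%N &
  forall t, (T <= t)%N ->
  forall zhat : profile D, slater_point D (sigma_FT D delta) zhat ->
    total_cost (x t) - J_MILP D <=
      Bound D M (sigma_FT D delta) zhat eps (y t) (mu t) (x t).
Proof.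
set sigma := sigma_FT D delta in lp_feas lp_uniq slater *.
have [zopt [zo _]] := lp_uniq.
have [zhat0 sl0] := slater.
have X0 i : locset D i !=set0.
  by have [x0 [_ Xx0]] := milp_feas; exists (x0 i); apply: Xx0.
have pen0 : 0 <= spread D / slater_gap D sigma zhat0.
  have cz := zo.1.2; rewrite divr_ge0 ?(ltW sl0.2) //.
  by have := total_cost_diff Pcompact cz cz; rewrite subrr.
exists (spread D / slater_gap D sigma zhat0 + 1); first by lra.
move=> M M_large alpha alpha_ge0 alpha_sum alpha_sqsum y mu x y_init.
move=> [Lmu ystep _] eps eps_gt0.
have M0 : 0 <= M by lra.
have Mpen : spread D / slater_gap D sigma zhat0 <= M by lra.
(* Allocations are gathered in a matrix whose row [i] belongs to agent [i]. *)
pose mx (v : 'I_N -> 'cV[R]_S) : 'M[R]_(N, S) := \matrix_(i, s) v i s 0.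
pose alloc (Z : 'M[R]_(N, S)) (i : 'I_N) : 'cV[R]_S := \col_s Z i s.
have allocK v i : alloc (mx v) i = v i.
  by apply/colP => s; rewrite !mxE.
pose F (Z : 'M[R]_(N, S)) : R := \sum_i J_loc D M i (alloc Z i).
have Fmx v : F (mx v) = \sum_i J_loc D M i (v i).
  by apply: eq_bigr => i _; rewrite allocK.
have mx_sum v : \sum_i v i = rhs D - sigma ->
    forall s, \sum_i mx v i s = (rhs D - sigma) s 0.
  by move=> <- s; rewrite summxE; apply: eq_bigr => i _; rewrite mxE.
have Y0sum := mx_sum _ y_init.
have Fge (Z : 'M[R]_(N, S)) : (forall s, \sum_i Z i s = (rhs D - sigma) s 0) ->
    total_cost zopt <= F Z.
  move=> Zs; apply: (sum_J_loc_ge Pcompact X0 sl0 zo Mpen).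
  apply/colP => s; rewrite summxE -Zs.
  by apply: eq_bigr => i _; rewrite mxE.
pose Ymin := mx (lp_allocation sigma zopt).
have Ymin_sum := mx_sum _ (lp_allocation_sum sigma zopt N_gt0).
have Ymin_le : F Ymin <= total_cost zopt.
  by rewrite Fmx; apply: lp_allocation_cost => //; exact: zo.1.
have [] := @laplacian_subgradient_cvg R N S e F (N%:R * M) M alpha
  (fun t => mx (y t)) (fun t => mx (mu t)) Ymin e_conn alpha_ge0 alpha_sum
  alpha_sqsum.
- by rewrite mulr_ge0.
- move=> eta Z Z' eta0 ZZ'.
  rewrite -mulrA mulr_natl -[X in _ *+ X](card_ord N) -sumr_const -big_split /=.
  apply: ler_sum => i _; apply: J_loc_lipschitz => // s; rewrite !mxE.
  exact: ZZ'.
- by move=> t i s; rewrite mxE; apply: multiplier_le (X0 i) (Lmu t i).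
- move=> t Z; rewrite Fmx.
  have -> : \tr ((mx (mu t))^T *m (Z - mx (y t))) =
            \sum_i dot (mu t i) (alloc Z i - y t i).
    under [RHS]eq_bigr => i _ do rewrite dotE.
    rewrite exchange_big /=; apply: eq_bigr => s _; rewrite mxE.
    by apply: eq_bigr => i _; rewrite !mxE.
  rewrite -big_split /=; apply: ler_sum => i _.
  exact: J_loc_subgradient (X0 i) (Lmu t i).
- move=> t; apply/matrixP => i s; rewrite mxE ystep [RHS]mxE.
  rewrite [in RHS]mxE [X in _ = _ + X]mxE lap_mxE mxE [X in _ + X]mxE summxE.
  by congr (_ + _ * _); apply: eq_bigr => j _; rewrite !mxE.
- by move=> s; rewrite Ymin_sum Y0sum.
- by move=> Z Zs; apply: (le_trans Ymin_le); apply: Fge => s; rewrite Zs Y0sum.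
move=> Z FZ Zcvg.
(* One accuracy serving all agents; the default value [1] of the minimum is
   harmless because only a positive lower bound matters. *)
have [epsmin emin0 emin] : exists2 epsmin, 0 < epsmin & forall i, epsmin <= eps i.
  exists (\big[Num.min/1]_i eps i); first by apply: lt_bigmin.
  by move=> i; apply: bigmin_le_cond.
have [T TP] := Zcvg _ emin0.
exists T.+1 => // t Tt zhat slz.
have FY : \sum_i J_loc D M i (y t i) <=
    total_cost zopt + \sum_i eps i * norm1 (mu t i).
  apply: (@le_trans _ _ (F Z + \sum_i eps i * norm1 (mu t i))); last first.
    by rewrite lerD2r (le_trans FZ).
  rewrite -big_split /=; apply: ler_sum => i _.
  apply: (le_trans (J_loc_subgradient (alloc Z i) (X0 i) (Lmu t i))).
  rewrite lerD2l; apply: dot_le_norm1 => s; rewrite !mxE.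
  apply: le_trans (emin i); have := TP t (ltnW Tt) i s.
  by rewrite mxE.
have LM := lp_le_milp N_gt0 Pcompact milp_feas slz zo.
rewrite /Bound sumrB -/(total_cost (x t)); move: FY LM; lra.
Qed.
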